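(* Let $X$ be a Banach space and let $\mathscr{F} \subset \mathscr{P}(\mathbb{N}_0)$ be a Furstenberg family. Then an operator $T \in \mathscr{L}(X)$ is $\mathscr{F}$-hypercyclic if and only if the operator $T \oplus Id_{\mathbb{C}} \in \mathscr{L}(X \oplus \mathbb{C})$ is $\mathscr{F}_{\mathbb{C}}$-hypercyclic.
   Context: $\mathbb{N}_0=\{0,1,2,\dots\}$ and $\mathscr{P}(\mathbb{N}_0)$ is the family of all subsets of $\mathbb{N}_0$. All Banach spaces are complex, separable and infinite-dimensional; $\mathscr{L}(X)$ is the space of bounded linear operators on $X$. A Furstenberg family is a family $\mathscr{F}\subset\mathscr{P}(\mathbb{N}_0)$ with $\emptyset\notin\mathscr{F}\neq\emptyset$ that is hereditarily upward: if $E\subset F \subset \mathbb{N}_0$ and $E\in\mathscr{F}$, then $F\in\mathscr{F}$. For $\Gamma\subset\mathbb{C}$, $T\in\mathscr{L}(X)$, $x\in X$ and $U\subset X$ put $\mathcal{N}_T(\Gamma x,U):=\{n\in\mathbb{N}_0: T^n(\Gamma x)\cap U\neq\emptyset\}$, where $\Gamma x=\{\lambda x:\lambda\in\Gamma\}$ and $T^0$ is the identity. The operator $T$ is $\mathscr{F}_\Gamma$-hypercyclic if there is $x\in X$ (called an $\mathscr{F}_\Gamma$-hypercyclic vector for $T$) such that $\mathcal{N}_T(\Gamma x,U)\in\mathscr{F}$ for every non-empty open set $U\subset X$. $\mathscr{F}$-hypercyclic means $\mathscr{F}_{\{1\}}$-hypercyclic. $X\oplus\mathbb{C}$ is $X\times\mathbb{C}$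 with norm $\|(x,\lambda)\|=\|x\|_X+|\lambda|$, $Id_{\mathbb{C}}$ is the identity operator on $\mathbb{C}$, and $(T\oplus Id_{\mathbb{C}})(x,\lambda)=(Tx,\lambda)$. *)

(* Defs.v *)
From HB Require Import structures.
From mathcomp Require Import all_boot all_order all_algebra.
From mathcomp Require Import complex.
From mathcomp Require Import all_classical all_reals all_analysis.

Set Implicit Arguments.
Unset Strict Implicit.
Unset Printing Implicit Defensive.

Import Order.TTheory GRing.Theory Num.Theory.

Local Open Scope classical_set_scope.
Local Open Scope ring_scope.

Definition separable (X : topologicalType) : Prop :=
  exists D : set X, countable D /\ dense D.

Definition infinite_dimensional (K : numFieldType) (X : lmodType K) : Prop :=
  ~ exists (n : nat) (e : 'I_n -> X),
      forall x, exists a : 'I_n -> K, x = \sum_(i < n) a i *: e i.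

Record bounded_operator (K : numFieldType) (X : normedModType K) :=
  BoundedOperator {
    op_linear :> {linear X -> X};
    op_bounded : exists M : K, forall x, `|op_linear x| <= M * `|x| }.

Lemma id_op_bounded (K : numFieldType) (X : normedModType K) :
  exists M : K, forall x : X, `|(idfun : {linear X -> X}) x| <= M * `|x|.
Proof. by exists 1 => x; rewrite mul1r. Qed.

Definition id_op (K : numFieldType) (X : normedModType K) :
  bounded_operator X := BoundedOperator (@id_op_bounded K X).

(* An alias of the product, because the library norms X * Y by the maximum
   of the two norms, whereas the direct sum carries their sum. *)
Definition dsum (K : numFieldType) (X Y : normedModType K) : Type :=
  (X * Y)%type.

Section DirectSum.
Variables (K : numFieldType) (X Y : normedModType K).

HB.instance Definition _ := GRing.Lmodule.copy (dsum X Y) (X * Y)%type.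

Definition dsum_norm (p : dsum X Y) : K := `|p.1| + `|p.2|.

Lemma dsum_normD (p q : dsum X Y) :
  dsum_norm (p + q) <= dsum_norm p + dsum_norm q.
Proof. by rewrite /dsum_norm addrACA lerD// ler_normD. Qed.

Lemma dsum_normZ (l : K) (p : dsum X Y) :
  dsum_norm (l *: p) = `|l| * dsum_norm p.
Proof. by rewrite /dsum_norm !normrZ mulrDr. Qed.

Lemma dsum_norm_eq0 (p : dsum X Y) : dsum_norm p = 0 -> p = 0.
Proof.
case: p => x y /eqP; rewrite /dsum_norm paddr_eq0//= !normr_eq0.
by move=> /andP[/eqP-> /eqP->].
Qed.

HB.instance Definition _ :=
  Lmodule_isNormed.Build K (dsum X Y) dsum_normD dsum_normZ dsum_norm_eq0.

Lemma dsum_normE (p : dsum X Y) : `|p| = `|p.1| + `|p.2|.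
Proof. by []. Qed.

Variables (S : bounded_operator X) (T : bounded_operator Y).

Definition dsum_fun (p : dsum X Y) : dsum X Y := (S p.1, T p.2).

Lemma dsum_fun_linear : linear dsum_fun.
Proof. by move=> a p q; rewrite /dsum_fun !linearP. Qed.

HB.instance Definition _ :=
  GRing.isLinear.Build K (dsum X Y) (dsum X Y) _ dsum_fun dsum_fun_linear.

Lemma dsum_fun_bounded :
  exists M : K, forall p : dsum X Y, `|dsum_fun p| <= M * `|p|.
Proof.
have [[M HM] [N HN]] := (op_bounded S, op_bounded T).
exists (`|M| + `|N|) => -[x y]; rewrite !dsum_normE /=.
have H (V : normedModType K) (A : bounded_operator V) (a : K) v :
    `|A v| <= a * `|v| -> `|A v| <= `|a| * `|v|.
  move=> h; apply: le_trans (h) _; rewrite -[X in _ <= _ * X]normr_id -normrM.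
  by apply/real_ler_norm/ger0_real; apply: le_trans h.
rewrite mulrDr; apply: lerD.
- by apply: le_trans (H _ _ _ _ (HM x)) _; rewrite ler_wpM2r// lerDl.
- by apply: le_trans (H _ _ _ _ (HN y)) _; rewrite ler_wpM2r// lerDr.
Qed.

Definition dsum_op : bounded_operator (dsum X Y) :=
  BoundedOperator dsum_fun_bounded.

End DirectSum.

Definition furstenberg_family (F : set (set nat)) : Prop :=
  [/\ ~ F set0, F !=set0 &
      forall E E' : set nat, E `<=` E' -> F E -> F E'].

Section Hypercyclicity.
Variables (K : numFieldType) (X : normedModType K).
Variables (F : set (set nat)) (Gamma : set K) (T : bounded_operator X).

Definition return_set (x : X) (U : set X) : set nat :=
  [set n | (iter n T @` [set l *: x | l in Gamma]) `&` U !=set0].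

Definition hypercyclic_vector (x : X) : Prop :=
  forall U : set X, open U -> U !=set0 -> F (return_set x U).

Definition gamma_hypercyclic : Prop := exists x : X, hypercyclic_vector x.

End Hypercyclicity.

Definition hypercyclic (K : numFieldType) (X : normedModType K)
    (F : set (set nat)) (T : bounded_operator X) : Prop :=
  gamma_hypercyclic F [set 1] T.

(* Main.v *)
Require Import Defs.
From mathcomp Require Import all_boot all_order all_algebra.
From mathcomp Require Import complex.
From mathcomp Require Import all_classical all_reals all_analysis.

Import Order.TTheory GRing.Theory Num.Theory.
Import numFieldNormedType.Exports.

Local Open Scope classical_set_scope.
Local Open Scope ring_scope.

(** The theorem is projective geometry: the second coordinate of
    [T (+) Id] is never moved, so it can be used to normalise the scalar that
    the [C]-orbit leaves free.  The scaled orbit of [(x, a)] consists of the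
    points [(l T^n x, l a)], and dividing the first coordinate by the second
    one gives [T^n (a^-1 x)], in which [l] no longer occurs.

    If [(x, a)] is a hypercyclic vector for [T (+) Id] with free scalars, then
    [a] is nonzero because the orbit meets the open set where the second
    coordinate is nonzero.  For an open [U] in [X], the cone of the [(w, m)]
    with [m] nonzero and [m^-1 w] in [U] is open ([open_affine_cone]), and a
    scaled orbit point with [l] nonzero lies in it exactly when
    [T^n (a^-1 x)] lies in [U], while [l = 0] never gives a point of it; so
    [a^-1 x] is hypercyclic for [T].

    Conversely, if [x] is hypercyclic for [T], then so is [(x, 1)] for
    [T (+) Id] with free scalars: a nonempty open set of the direct sum has a
    point [(y, m)] with [m] nonzero ([open_dsum_snd_neq0]), its slice
    consisting of the [w] with [(m w, m)] in the set is open and nonempty, and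
    whenever [T^n x] is in that slice the scalar [m] brings the orbit of
    [(x, 1)] into the set.  In both directions one return set is included in
    another, and upward heredity of the family concludes. *)

Section DirectSumTopology.
Context {K : numFieldType} {X Y : normedModType K}.

Lemma continuous_dsum_fst : continuous (fun p : dsum X Y => p.1).
Proof.
move=> p; apply/(@cvgrPdist_lt _ _ _ (nbhs p)) => e e0; near=> q.
have : `|p - q| < e by near: q; apply: cvgr_dist_lt => //; exact: cvg_id.
by rewrite dsum_normE; apply: le_lt_trans; rewrite lerDl.
Unshelve. all: by end_near. Qed.

Lemma continuous_dsum_snd : continuous (fun p : dsum X Y => p.2).
Proof.
move=> p; apply/(@cvgrPdist_lt _ _ _ (nbhs p)) => e e0; near=> q.
have : `|p - q| < e by near: q; apply: cvgr_dist_lt => //; exact: cvg_id.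
by rewrite dsum_normE; apply: le_lt_trans; rewrite lerDr.
Unshelve. all: by end_near. Qed.

Lemma cvg_dsum (T : Type) (G : set_system T) (FG : Filter G)
    (f : T -> X) (g : T -> Y) (x : X) (y : Y) :
  f @ G --> x -> g @ G --> y ->
  (fun t => (f t, g t) : dsum X Y) @ G --> ((x, y) : dsum X Y).
Proof.
move=> fx gy; apply/cvgrPdist_lt => e e0; near=> t.
rewrite dsum_normE /= [ltRHS]splitr; apply: ltrD; near: t.
- by apply: cvgr_dist_lt => //; rewrite divr_gt0.
- by apply: cvgr_dist_lt => //; rewrite divr_gt0.
Unshelve. all: by end_near. Qed.

End DirectSumTopology.

Section ScalarSummand.
Context {K : numFieldType} {X : normedModType K}.

(** In the chart [m != 0], the map [(w, m) |-> m^-1 w] is continuous. *)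
Lemma open_affine_cone (U : set X) : open U ->
  open [set p : dsum X K^o | p.2 != 0 /\ U (p.2^-1 *: p.1)].
Proof.
move=> oU; rewrite openE => p [p20 Up].
have cp : (fun q : dsum X K^o => (q.2 : K)^-1 *: q.1) @ p --> p.2^-1 *: p.1.
  have FF : Filter (nbhs p) := nbhs_filter p.
  apply: (@cvgZ _ _ _ _ FF); last exact: continuous_dsum_fst.
  exact: (@cvgV _ _ _ FF _ _ p20 (@continuous_dsum_snd _ _ K^o p)).
near=> q; split.
- by near: q; apply: (cvgr_neq0 _ (@continuous_dsum_snd _ _ K^o p)).
- by near: q; apply: (cp U); exact: open_nbhs_nbhs.
Unshelve. all: by end_near. Qed.

(** The scalar line has no isolated point, so a vanishing second coordinate can
    be perturbed. *)
Lemma open_dsum_snd_neq0 (V : set (dsum X K^o)) : open V -> V !=set0 ->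
  exists (y : X) (m : K), m != 0 /\ V (y, m).
Proof.
move=> oV [[y m] Vym]; have [m0|m0] := eqVneq m 0; last by exists y, m.
have Vy : \forall t \near (0 : K), V (y, t).
  have cy : (fun t : K => (y, t) : dsum X K^o) @ (0 : K)
      --> ((y, 0) : dsum X K^o).
    have FF : Filter (nbhs (0 : K)) := nbhs_filter _.
    by apply: (@cvg_dsum _ _ _ _ _ FF); [exact: (@cvg_cst _ y)|exact: cvg_id].
  by apply: (cy V); apply: open_nbhs_nbhs; split => //; rewrite -m0.
have [t [Vt t0]] : exists t : K, V (y, t) /\ t != 0.
  have neq0 : \forall t \near (0 : K)^', t != 0 by exact: nbhs_dnbhs_neq.
  by apply: (@filter_ex _ (0 : K)^'); apply: filterI neq0; exact: nbhs_dnbhs.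
by exists y, t.
Qed.

Lemma open_dsum_slice (V : set (dsum X K^o)) (m : K) : open V ->
  open [set w : X | V (m *: w, m)].
Proof.
move=> oV; apply: (@open_comp _ _ (fun w : X => (m *: w, m) : dsum X K^o)) => //.
move=> w _; have FF : Filter (nbhs w) := nbhs_filter w.
apply: (@cvg_dsum _ _ _ _ _ FF); last exact: (@cvg_cst _ (m : K^o)).
exact: scaler_continuous.
Qed.

End ScalarSummand.

Section Iterates.
Context {K : numFieldType} {X : normedModType K} (T : bounded_operator X).

Lemma iter_opZ (n : nat) (l : K) (x : X) : iter n T (l *: x) = l *: iter n T x.
Proof. by elim: n => //= n ->; rewrite linearZ. Qed.

Lemma iter_dsum_id (n : nat) (p : dsum X K^o) :
  iter n (dsum_op T (id_op K^o)) p = (iter n T p.1, p.2).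
Proof. by elim: n => [|n /= ->//]; case: p. Qed.

Lemma return_set1E (x : X) (U : set X) :
  return_set [set 1] T x U = [set n | U (iter n T x)].
Proof.
apply/seteqP; split => n /=.
- by move=> [_ [[_ [_ -> <-] <-]]]; rewrite scale1r.
- move=> Un; exists (iter n T x); split => //; exists x => //.
  by exists 1 => //; rewrite scale1r.
Qed.

Lemma return_set_dsum_idE (p : dsum X K^o) (V : set (dsum X K^o)) :
  return_set [set: K] (dsum_op T (id_op K^o)) p V =
  [set n | exists l : K, V (l *: iter n T p.1, l * p.2)].
Proof.
apply/seteqP; split => n /=.
- move=> [_ [[_ [l _ <-] <-]]]; rewrite iter_dsum_id /= iter_opZ => Vl.
  by exists l.
- move=> [l Vl]; exists (l *: iter n T p.1, l * p.2); split => //.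
  exists (l *: p); first by exists l.
  by rewrite iter_dsum_id /= iter_opZ.
Qed.

End Iterates.

Section HypercyclicVectors.
Context {K : numFieldType} {X : normedModType K}.
Context {F : set (set nat)} (HF : furstenberg_family F).
Context {T : bounded_operator X}.

Lemma hypercyclic_vector_pair1 (x : X) :
  hypercyclic_vector F [set 1] T x ->
  hypercyclic_vector F [set: K] (dsum_op T (id_op K^o)) ((x, 1) : dsum X K^o).
Proof.
case: HF => _ _ Fup hx V oV V0.
have [y [m [m0 Vym]]] := open_dsum_snd_neq0 _ oV V0.
have W0 : [set w : X | V (m *: w, m)] !=set0.
  by exists (m^-1 *: y); rewrite /= scalerA mulfV// scale1r.
apply: Fup (hx _ (open_dsum_slice _ m oV) W0).
rewrite return_set1E return_set_dsum_idE => n /= Vn.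
by exists m; rewrite mulr1.
Qed.

Lemma hypercyclic_vector_snd_neq0 (p : dsum X K^o) :
  hypercyclic_vector F [set: K] (dsum_op T (id_op K^o)) p -> p.2 != 0.
Proof.
case: HF => F0 _ _ hp; apply/eqP => p20; apply: F0.
have C0 : [set q : dsum X K^o | q.2 != 0 /\ setT (q.2^-1 *: q.1)] !=set0.
  by exists (0, 1); split => //=; exact: oner_neq0.
have := hp _ (open_affine_cone _ openT) C0.
rewrite return_set_dsum_idE; congr F; apply/seteqP; split => // n /= [l [+ _]].
by rewrite p20 mulr0 eqxx.
Qed.

Lemma hypercyclic_vector_normalize (p : dsum X K^o) :
  hypercyclic_vector F [set: K] (dsum_op T (id_op K^o)) p ->
  hypercyclic_vector F [set 1] T ((p.2 : K)^-1 *: p.1).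
Proof.
move=> hp U oU [u Uu]; have p20 := hypercyclic_vector_snd_neq0 _ hp.
case: HF => _ _ Fup.
have C0 : [set q : dsum X K^o | q.2 != 0 /\ U (q.2^-1 *: q.1)] !=set0.
  by exists (u, 1); split => /=; [exact: oner_neq0|rewrite invr1 scale1r].
apply: Fup (hp _ (open_affine_cone _ oU) C0).
rewrite return_set1E return_set_dsum_idE => n /= [l [+ +]].
rewrite mulf_eq0 negb_or => /andP[l0 _].
(* The free scalar cancels: (l a)^-1 (l v) = a^-1 v. *)
by rewrite scalerA invfM mulrAC mulVf// mul1r iter_opZ.
Qed.

End HypercyclicVectors.

Theorem theorem2p1 (R : realType) (X : completeNormedModType R[i])
    (X_separable : separable X) (X_infdim : infinite_dimensional X)
    (F : set (set nat)) (HF : furstenberg_family F)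
    (T : bounded_operator X) :
  hypercyclic F T <->
  gamma_hypercyclic F [set: R[i]] (dsum_op T (id_op R[i]^o)).
Proof.
split=> [[x hx]|[p hp]].
- by exists (x, 1); exact: hypercyclic_vector_pair1.
- by exists (p.2^-1 *: p.1); exact: hypercyclic_vector_normalize.
Qed.
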